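(* Let $\mathscr{L}$ be the class of lower dismantlable lattices whose greatest element $1$ is join-reducible. For $L_1, L_2\in\mathscr{L}$, the zero-divisor graphs $G_{\{0\}}(L_1)$ and $G_{\{0\}}(L_2)$ are isomorphic (as graphs) if and only if $L_1$ and $L_2$ are isomorphic (as lattices).
   Context: All lattices are finite, with least element $0$ and greatest element $1$. Write $x\prec y$ if $y$ covers $x$. Adjunct operation: let $L_1, L_2$ be disjoint finite lattices and $a<b$ in $L_1$ with $a\not\prec b$. The adjunct $L_1]_a^b L_2$ is the set $L_1\cup L_2$ with the order: $x\le y$ iff $x,y\in L_1$ and $x\le y$ in $L_1$; or $x,y\in L_2$ and $x\le y$ in $L_2$; or $x\in L_1$, $y\in L_2$ and $x\le a$ in $L_1$; or $x\in L_2$, $y\in L_1$ and $b\le y$ in $L_1$. This is a lattice, and $(a,b)$ is called an adjunct pair. A finite lattice $L$ with $n$ elements is dismantlable if there is a chain $S_1\subset S_2\subset\cdots\subset S_n=L$ of sublattices with $|S_i|=i$; equivalently (known structure theorem) $L$ is an iterated adjunct of chains, $L=(\cdots((C_0]_{a_1}^{b_1}C_1)]_{a_2}^{b_2}C_2)\cdots)]_{a_r}^{b_r}C_r$ with each $C_i$ a chain (an adjunct representation). It is known that the adjunct pairs, with multiplicity, do not depend on the representation. A dismantlable lattice $L$ is lower dismantlable if it is a chain or every adjunct pair in $L$ is of the form $(0,b)$ for some $b\in L$. An element $x$ is join-reducible if $x=y\vee z$ for some $y,z$ both distinct from $x$. The zero-divisor graph $G_{\{0\}}(L)$ is the simple undirected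 graph with vertex set $\{x\in L\setminus\{0\} : x\wedge y=0 \text{ for some } y\in L\setminus\{0\}\}$, in which two distinct vertices $x,y$ are adjacent iff $x\wedge y=0$. *)

(* Defs.v *)
From HB Require Import structures.
From mathcomp Require Import all_boot all_order.

Set Implicit Arguments.
Unset Strict Implicit.
Unset Printing Implicit Defensive.

Import Order.TTheory.
Local Open Scope order_scope.

(* Finite lattices are [finTBLatticeType]s: nonempty, with [\bot] and [\top]
   for 0 and 1. *)

Section Lattices.
Variables (d : Order.disp_t) (L : finTBLatticeType d).
Implicit Types (S C : {set L}) (a b x y : L).

Definition sublattice S : Prop :=
  [/\ S != set0, Order.ClosedPredicates.meet_closed S
    & Order.ClosedPredicates.join_closed S].

Definition dismantlable : Prop :=
  exists S : nat -> {set L},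
    [/\ forall i, (1 <= i <= #|L|)%N -> sublattice (S i) /\ #|S i| = i,
        forall i, (1 <= i < #|L|)%N -> S i \proper S i.+1
      & S #|L| = [set: L]].

Definition chain C : Prop := C != set0 /\ {in C &, forall x y, x >=< y}.

Definition covers_in S a b : Prop :=
  [/\ a \in S, b \in S, a < b & forall z, z \in S -> ~~ (a < z < b)].

(* The order of the adjunct S]_a^b C, where S and C carry the order of L. *)
Definition adjunct_le S C a b x y : bool :=
  [|| [&& x \in S, y \in S & x <= y],
      [&& x \in C, y \in C & x <= y],
      [&& x \in S, y \in C & x <= a]
    | [&& x \in C, y \in S & b <= y]].

(* "D = S]_a^b C", for subsets S, C, D of L ordered by restriction. *)
Definition is_adjunct S C a b (D : {set L}) : Prop :=
  [/\ [disjoint S & C],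
      [/\ a \in S, b \in S, a < b & ~ covers_in S a b],
      D = S :|: C
    & {in D &, forall x y, (x <= y) = adjunct_le S C a b x y}].

(* [adjunct_rep D ps]: the subset D has an adjunct representation
   (..(C_0]_{a_1}^{b_1} C_1)..)]_{a_r}^{b_r} C_r by chains C_i, where
   ps = [:: (a_1, b_1); ..; (a_r, b_r)]. *)
Inductive adjunct_rep : {set L} -> seq (L * L) -> Prop :=
  | AdjunctRepChain C : chain C -> adjunct_rep C [::]
  | AdjunctRepStep S C a b D ps :
      adjunct_rep S ps -> chain C -> is_adjunct S C a b D ->
      adjunct_rep D (rcons ps (a, b)).

Definition adjunct_pair a b : Prop :=
  exists2 ps, adjunct_rep [set: L] ps & (a, b) \in ps.

Definition lower_dismantlable : Prop :=
  dismantlable /\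
  (chain [set: L] \/ forall a b, adjunct_pair a b -> a = \bot).

Definition join_reducible x : Prop :=
  exists y z, [/\ y != x, z != x & x = y `|` z].

Definition lower_dismantlable_top_reducible : Prop :=
  lower_dismantlable /\ join_reducible \top.

Definition zd_vertex x : bool :=
  (x != \bot) && [exists y, (y != \bot) && (x `&` y == \bot)].

Definition zd_adj : rel {x : L | zd_vertex x} :=
  fun u v => (u != v) && (val u `&` val v == \bot).

Lemma zd_adj_sym : symmetric zd_adj.
Proof. by move=> u v; rewrite /zd_adj eq_sym meetC. Qed.

Lemma zd_adj_irrefl : irreflexive zd_adj.
Proof. by move=> u; rewrite /zd_adj eqxx. Qed.

End Lattices.

Record sgraph := SGraph {
  vertex : finType;
  adj : rel vertex;
  adj_sym : symmetric adj;
  adj_irrefl : irreflexive adj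
}.

Definition graph_isomorphic (G H : sgraph) : Prop :=
  exists2 f : vertex G -> vertex H,
    bijective f & forall u v, adj (f u) (f v) = adj u v.

Definition zero_divisor_graph d (L : finTBLatticeType d) : sgraph :=
  SGraph (@zd_adj_sym d L) (@zd_adj_irrefl d L).

Definition lattice_isomorphic d1 (L1 : latticeType d1) d2
    (L2 : latticeType d2) : Prop :=
  exists f : {lmorphism L1 -> L2}, bijective f.

(* Main.v *)
From HB Require Import structures.
Require Import Defs.
From mathcomp Require Import all_boot all_order.

(** Write 0 and 1 for the least and greatest elements.  In a lower dismantlable
    lattice each chain of an adjunct representation is hung between 0 and some
    [b], so the elements above any nonzero element form a chain: the nonzero
    part of the lattice is a tree with root 1 ([upsets_chain],
    [lower_dismantlable_upsets_chain]).  For this to follow from a condition on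
    all adjunct pairs, some adjunct representation must exist; this is the
    structure theorem [adjunct_rep_exists], proved by adding the elements of
    the lattice one at a time.

    In such a tree two nonzero elements meet in 0 exactly when they are
    incomparable, so the zero-divisor graph is the incomparability graph.  It
    almost determines the order through annihilators: for [x] and [y]
    comparable, a strict inclusion between the annihilators decides which of
    the two is larger ([le_annihilatorE]).  The only ambiguity is between
    elements with the same annihilator (twins), but twins form a chain.  A
    bijection that preserves the relation [x `&` y = 0] therefore becomes an
    order isomorphism once it is corrected inside each class of twins so as to
    match the two chains in increasing order ([twin_match],
    [meet0_bijection_isomorphic]).

    When 1 is join-reducible, every element other than 0 and 1 is a vertex of
    the graph ([top_reducible_zd_vertex]), so a graph isomorphism extended by
    0 |-> 0 and 1 |-> 1 is such a bijection.  The converse implication is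
    immediate: a lattice isomorphism preserves 0 and meets. *)

Set Implicit Arguments.
Unset Strict Implicit.
Unset Printing Implicit Defensive.

Import Order.TTheory.
Local Open Scope order_scope.

(** * Existence of adjunct representations *)

Section Structure.
Variables (d : Order.disp_t) (L : finTBLatticeType d).
Implicit Types (S C D : {set L}) (a b x y : L).

(** Only the comparisons between a point of [S] and a point of [C] carry
    information; this form spares the case analysis hidden in
    [adjunct_le]. *)
Lemma adjunct_orderP S C a b : [disjoint S & C] ->
  {in S :|: C &, forall x y, (x <= y) = adjunct_le S C a b x y} <->
  {in S & C, forall s c, (s <= c) = (s <= a) /\ (c <= s) = (b <= s)}.
Proof.
move=> dSC.
have CS s : s \in S -> s \in C = false by exact: disjointFr.
have SC c : c \in C -> c \in S = false by exact: disjointFl.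
split=> [H s c sS cC | H x y].
  have [sD cD] : s \in S :|: C /\ c \in S :|: C by rewrite !inE sS cC orbT.
  by rewrite (H s c) // (H c s) // /adjunct_le sS cC (CS s) ?(SC c) //= orbF.
rewrite !inE /adjunct_le => /orP[xS | xC] /orP[yS | yC].
- by rewrite xS yS (CS x) ?(CS y) //= !orbF.
- by rewrite xS yC (CS x) ?(SC y) //= orbF; case: (H x y).
- by rewrite xC yS (SC x) ?(CS y) //=; case: (H y x).
by rewrite xC yC (SC x) ?(SC y) //= !orbF.
Qed.

Lemma disjoint_setU1 x S C : x \notin C -> [disjoint S & C] ->
  [disjoint x |: S & C].
Proof.
move=> xC dSC; rewrite disjoint_subset; apply/subsetP=> s /setU1P[-> //|sS].
by rewrite inE (disjointFr dSC sS).
Qed.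

Lemma chain_insert C x a b : chain C ->
    {in C, forall c, (c <= x) = (c <= a)} ->
    {in C, forall c, (x <= c) = (b <= c)} ->
    {in C, forall c, (c <= a) || (b <= c)} ->
  chain (x |: C).
Proof.
move=> [C0 Cc] xa xb ab.
have xc c : c \in C -> x >=< c.
  by move=> cC; rewrite /Order.comparable xa // xb // orbC ab.
split; first by apply/set0Pn; exists x; rewrite setU11.
move=> u v; rewrite !inE => /predU1P[-> | uC] /predU1P[-> | vC] //.
- exact: comparablexx.
- exact: xc.
- by rewrite comparable_sym xc.
exact: Cc.
Qed.

Lemma is_adjunctP S C a b D : is_adjunct S C a b D ->
  [/\ [disjoint S & C], [/\ a \in S, b \in S, a < b & ~ covers_in S a b],
      D = S :|: C
    & {in S & C, forall s c, (s <= c) = (s <= a) /\ (c <= s) = (b <= s)}].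
Proof. by case=> dSC ab -> /(adjunct_orderP _ _ dSC). Qed.

Lemma is_adjunctI S C a b : [disjoint S & C] ->
    [/\ a \in S, b \in S, a < b & ~ covers_in S a b] ->
    {in S & C, forall s c, (s <= c) = (s <= a) /\ (c <= s) = (b <= s)} ->
  is_adjunct S C a b (S :|: C).
Proof. by move=> dSC ab H; split=> //; apply/(adjunct_orderP _ _ dSC). Qed.

Lemma chain_covers C a b c : chain C -> covers_in C a b -> c \in C ->
  (c <= a) || (b <= c).
Proof.
case=> _ Cc [aC bC ab nab] cC; apply/norP=> -[ca bc].
have /negP[] := nab c cC; apply/andP; split.
  by case: (comparable_ltgtP (Cc c a cC aC)) ca.
by case: (comparable_ltgtP (Cc c b cC bC)) bc.
Qed.

(** Here [x] subdivides the edge from [a] to [b] of the diagram of [S].  Going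
    back along the construction of [S], that edge either lies in the smaller
    lattice, where induction applies, or touches the chain [C] glued last: it
    lies inside [C] or joins an end of [C] to [a'] or to [b'].  In the latter
    cases [x] is absorbed into [C], with the same adjunct pair. *)
Lemma adjunct_rep_subdivide S ps : adjunct_rep S ps -> forall a b x,
    x \notin S -> covers_in S a b ->
    {in S, forall s, (s <= x) = (s <= a)} ->
    {in S, forall s, (x <= s) = (b <= s)} ->
  exists qs, adjunct_rep (x |: S) qs.
Proof.
elim=> {S ps} [C Cc | S C a' b' D ps repS IH Cc /is_adjunctP].
  move=> a b x xC cab xa xb; exists [::]; constructor.
  by apply: (chain_insert Cc xa xb) => c; exact: chain_covers cab.
move=> [dSC [a'S b'S ab' ncov'] -> SC] a b x; rewrite inE negb_or.
move=> /andP[xS xC] [aD bD ab nab] xa xb.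
have sS s : s \in S -> s \in S :|: C by rewrite inE => ->.
have sC c : c \in C -> c \in S :|: C by rewrite inE orbC => ->.
have ins_chain :
    {in S, forall s, (s <= x) = (s <= a') /\ (x <= s) = (b' <= s)} ->
    {in C, forall c, (c <= a) || (b <= c)} ->
    exists qs, adjunct_rep (x |: (S :|: C)) qs.
  move=> Sx Cx; exists (rcons ps (a', b')).
  apply: (AdjunctRepStep repS (C := x |: C)).
    by apply: (@chain_insert C x a b) => // c /sC cD; auto.
  rewrite setUCA; apply: is_adjunctI => //.
    by rewrite disjoint_sym disjoint_setU1 // disjoint_sym.
  by move=> s c sS' /setU1P[-> | cC]; [apply: Sx | apply: SC].
case/setUP: aD => [aS | aC]; case/setUP: bD => [bS | bC].
- have cab : covers_in S a b by split=> // z /sS; exact: nab.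
  have [||qs rep] := IH a b x xS cab; try by move=> s /sS; auto.
  exists (rcons qs (a', b')); rewrite setUA.
  apply: (AdjunctRepStep rep Cc); apply: is_adjunctI.
  - exact: disjoint_setU1.
  - split; rewrite ?inE ?a'S ?b'S ?orbT // => -[_ _ _ n]; apply: ncov'.
    by split=> // z zS; apply: n; rewrite inE zS orbT.
  move=> s c /setU1P[-> | sS'] cC; last exact: SC.
  rewrite (xa c (sC _ cC)) (xb c (sC _ cC)).
  rewrite (xa b' (sS _ b'S)) (xb a' (sS _ a'S)).
  by have [_ ->] := SC _ _ aS cC; have [-> _] := SC _ _ bS cC.
- (* The edge enters C from below, so it starts at a'. *)
  have lt_a'b : a' < b.
    rewrite lt_neqAle (SC _ _ a'S bC).1 lexx andbT.
    by apply: contraTneq bC => <-; rewrite (disjointFr dSC).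
  have ea : a = a'.
    have := nab a' (sS _ a'S); rewrite lt_a'b andbT => n; apply/eqP; move: n.
    by apply: contraNT => ne; rewrite lt_neqAle ne -(SC _ _ aS bC).1 ltW.
  apply: ins_chain => [s sS' | c cC].
    by rewrite (xa s) ?(xb s) ?sS // ea (SC s b sS' bC).2.
  apply/orP; case: (comparable_leP (Cc.2 _ _ bC cC)) => [|ltcb].
    by right.
  left; have := nab c (sC _ cC); rewrite ltcb andbT.
  rewrite lt_neqAle (SC _ _ aS cC).1 {2}ea lexx andbT negbK => /eqP->.
  exact: lexx.
- (* The edge leaves C from above, so it ends at b'. *)
  have lt_ab' : a < b'.
    rewrite lt_neqAle (SC _ _ b'S aC).2 lexx andbT.
    by apply: contraTneq aC => ->; rewrite (disjointFr dSC).
  have eb : b = b'.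
    have := nab b' (sS _ b'S); rewrite lt_ab' /= => n; apply/eqP; move: n.
    by apply: contraNT => ne; rewrite lt_neqAle eq_sym ne -(SC _ _ bS aC).2 ltW.
  apply: ins_chain => [s sS' | c cC].
    by rewrite (xa s) ?(xb s) ?sS // eb (SC s a sS' aC).1.
  apply/orP; case: (comparable_leP (Cc.2 _ _ cC aC)) => [|ltac].
    by left.
  right; have := nab c (sC _ cC); rewrite ltac /=.
  rewrite lt_neqAle (SC _ _ bS cC).2 {2}eb lexx andbT negbK => /eqP->.
  exact: lexx.
apply: ins_chain => [s sS' | c cC].
  by rewrite (xa s) ?(xb s) ?sS // (SC s a sS' aC).1 (SC s b sS' bC).2.
apply: (chain_covers Cc) cC; split=> // z /sC; exact: nab.
Qed.

(** Since [S] is a sublattice with the bounds of [L], there are a largest [a]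
    below and a smallest [b] above [x] in [S], and all comparisons of [x] with
    [S] go through them.  If [S] has a point strictly between [a] and [b] then
    [x] is glued as a one-point chain; otherwise it subdivides an edge. *)
Lemma adjunct_rep_insert S ps x : adjunct_rep S ps -> \bot \in S ->
    \top \in S -> Order.ClosedPredicates.meet_closed S ->
    Order.ClosedPredicates.join_closed S -> x \notin S ->
  exists qs, adjunct_rep (x |: S) qs.
Proof.
move=> repS S0 S1 SI SU xS.
pose a := \join_(s in S | s <= x) s; pose b := \meet_(s in S | x <= s) s.
have aS : a \in S by apply: (big_ind [in S]) => // s /andP[].
have bS : b \in S by apply: (big_ind [in S]) => // s /andP[].
have neS s : s \in S -> s != x by move=> sS; apply: contraNneq xS => <-.
have lt_ax : a < x.
  by rewrite lt_neqAle neS //=; apply/joinsP=> s /andP[].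
have lt_xb : x < b.
  by rewrite lt_neqAle eq_sym neS //=; apply/meetsP=> s /andP[].
have xa : {in S, forall s, (s <= x) = (s <= a)}.
  move=> s sS; apply/idP/idP=> [le_sx | /le_trans->//]; last exact: ltW.
  by apply: (joins_sup_seq (P := [pred s | _ & _])) => /=;
    rewrite ?mem_index_enum ?sS.
have xb : {in S, forall s, (x <= s) = (b <= s)}.
  move=> s sS; apply/idP/idP=> [le_xs | ]; last by apply/le_trans/ltW.
  by apply: (meets_inf_seq (P := [pred s | _ & _])) => /=;
    rewrite ?mem_index_enum ?sS.
have lt_ab := lt_trans lt_ax lt_xb.
case: (boolP [exists z in S, a < z < b]) => [/existsP[z /andP[zS azb]] | nz].
  exists (rcons ps (a, b)); rewrite setUC.
  apply: (AdjunctRepStep repS (C := [set x])).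
    split; first by apply/set0Pn; exists x; rewrite set11.
    by move=> u v /set1P-> /set1P->; exact: comparablexx.
  apply: is_adjunctI; first by rewrite disjoint_sym disjoints1.
    by split=> // -[_ _ _ /(_ z zS)]; rewrite azb.
  by move=> s c sS /set1P->; rewrite xa // xb.
apply: (adjunct_rep_subdivide repS (a := a) (b := b)) => //; split=> // z zS.
by apply: contra nz => azb; apply/existsP; exists z; rewrite zS.
Qed.

(** The two bounds are added to every sublattice of the given tower, so that
    each new point has points of the previous stage on both sides. *)
Lemma adjunct_rep_exists : dismantlable L ->
  exists ps, adjunct_rep [set: L] ps.
Proof.
case=> S [subS incS SL]; have n0 : (0 < #|L|)%N by apply/card_gt0P; exists \bot.
rewrite -SL.
suff H i : (i < #|L|)%N ->
    exists ps, adjunct_rep (\bot |: (\top |: S i.+1)) ps.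
  have := H #|L|.-1; rewrite prednK // SL => /(_ (leqnn _)).
  by rewrite !(setUidPr _) ?subsetT.
elim: i => [i_lt | i IH i_lt].
  have [_ /eqP/cards1P[x ->]] := subS 1%N i_lt.
  exists [::]; constructor; split.
    by apply/set0Pn; exists \bot; rewrite setU11.
  by move=> u v; rewrite !inE => /or3P[]/eqP-> /or3P[]/eqP->;
     rewrite /Order.comparable ?le0x ?lex1 ?lexx ?orbT.
have [ps rep] := IH (ltnW i_lt).
have [[_ SI SU] cardS] := subS i.+1 (ltnW i_lt).
have [_ cardS'] := subS i.+2 i_lt.
have {}incS : S i.+1 \proper S i.+2 by apply: incS.
have [sub [x xS' xS]] := properP incS.
have -> : S i.+2 = x |: S i.+1.
  apply/esym/eqP; rewrite eqEcard subUset sub1set xS' sub /=.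
  by rewrite cardsU1 xS cardS cardS'.
rewrite (setUCA _ [set x]) (setUCA _ [set x]).
set T := \bot |: _ in rep *.
case: (boolP (x \in T)) => [xT | xT].
  by exists ps; rewrite (setUidPr _) ?sub1set.
apply: (adjunct_rep_insert rep) => //; rewrite ?inE ?eqxx ?orbT //.
  move=> u v; rewrite !inE => /or3P[/eqP->|/eqP->|uS] /or3P[/eqP->|/eqP->|vS];
  by rewrite ?(meet0x, meetx0, meet1x, meetx1) ?eqxx ?uS ?vS ?SI ?orbT.
move=> u v; rewrite !inE => /or3P[/eqP->|/eqP->|uS] /or3P[/eqP->|/eqP->|vS];
by rewrite ?(join0x, joinx0, join1x, joinx1) ?eqxx ?uS ?vS ?SU ?orbT.
Qed.

End Structure.

(** * The tree of nonzero elements *)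

(** The nonzero elements form a tree growing downwards from the top. *)
Definition upsets_chain (d : Order.disp_t) (L : finTBLatticeType d) : Prop :=
  forall x y z : L, x != \bot -> x <= y -> x <= z -> y >=< z.

Section Tree.
Variables (d : Order.disp_t) (L : finTBLatticeType d).
Implicit Types (S C D : {set L}) (a b x y z : L).

(** A chain glued between 0 and [b] is a new branch below [b]: nothing nonzero
    lies below it, and outside itself only the points above [b] are above
    it. *)
Lemma adjunct_rep_upsets_chain D ps : adjunct_rep D ps ->
    {in ps, forall p, p.1 = \bot} ->
  {in D & &, forall x y z, x != \bot -> x <= y -> x <= z -> y >=< z}.
Proof.
elim=> {D ps} [C [_ Cc] _ x y z _ yC zC _ _ _ | ]; first exact: Cc.
move=> S C a b D ps _ IH [_ Cc] /is_adjunctP[_ [_ bS lt_ab _] -> SC] ps0.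
have a0 : a = \bot by apply: (ps0 (a, b)); rewrite mem_rcons mem_head.
have b0 : b != \bot by rewrite -lt0x -a0.
have /IH {}IH : {in ps, forall p, p.1 = \bot}.
  by move=> p pps; apply: ps0; rewrite mem_rcons inE pps orbT.
have abovexS x c : x \in S -> c \in C -> x != \bot -> x <= c = false.
  by move=> xS cC x0; rewrite (SC x c xS cC).1 a0 lex0 (negPf x0).
move=> x y z /setUP[xS | xC] yD zD x0.
  have inS t : t \in S :|: C -> x <= t -> t \in S.
    by case/setUP=> // tC; rewrite abovexS.
  by move=> le_xy le_xz; apply: (IH x y z) => //; apply: inS.
case/setUP: yD zD => [yS | yC] /setUP[zS | zC].
- by rewrite (SC y x yS xC).2 (SC z x zS xC).2; exact: (IH b y z).
- rewrite (SC y x yS xC).2 -(SC y z yS zC).2 => le_zy _.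
  by rewrite /Order.comparable le_zy orbT.
- rewrite (SC z x zS xC).2 -(SC z y zS yC).2 => _ le_yz.
  by rewrite /Order.comparable le_yz.
by move=> _ _; apply: Cc.
Qed.

Lemma lower_dismantlable_upsets_chain :
  lower_dismantlable L -> upsets_chain L.
Proof.
case=> /adjunct_rep_exists[ps rep] [[_ Cc] | pairs0] x y z.
  by move=> _ _ _; apply: Cc; rewrite inE.
apply: (adjunct_rep_upsets_chain rep); rewrite ?inE // => -[a b] abps.
by apply: (pairs0 a b); exists ps.
Qed.

(** * Recovering the order from annihilators *)

Definition annihilator x := [set y | x `&` y == \bot].

Definition twins x := [set y | annihilator y == annihilator x].

Lemma subset_annihilator x y : x <= y -> annihilator y \subset annihilator x.
Proof.
move=> le_xy; apply/subsetP=> z; rewrite !inE -!lex0.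
by apply: le_trans; rewrite leI2.
Qed.

Hypothesis tree : upsets_chain L.

Lemma comparable_meet_neq0 x y : x `&` y != \bot -> x >=< y.
Proof. by move=> xy0; apply: tree xy0 _ _; rewrite ?leIl ?leIr. Qed.

(** A nonzero element does not annihilate itself, hence does not annihilate its
    twins either. *)
Lemma twins_comparable x y : annihilator x = annihilator y -> x >=< y.
Proof.
move=> eq_xy; case: (eqVneq (x `&` y) \bot) => [xy0 |]; last first.
  exact: comparable_meet_neq0.
have : y \in annihilator y by rewrite -eq_xy inE xy0.
by rewrite inE meetxx => /eqP->; rewrite /Order.comparable le0x orbT.
Qed.

(** Annihilators decrease along the order, so a strict inclusion excludes one
    of the two ways in which [x] and [y] can be compared.  The relation
    [x <= y] occurs on the right as well, but only for twins: everywhere else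
    the order is read off the relation of meeting in 0. *)
Lemma le_annihilatorE x y : (x <= y) =
  (x == \bot) || (x `&` y != \bot) && ((annihilator y \proper annihilator x)
    || (annihilator x == annihilator y) && (x <= y)).
Proof.
case: eqVneq => [-> | x0 /=]; first exact: le0x.
apply/idP/andP=> [le_xy | [xy0 /orP[lt_yx | /andP[]//]]].
  rewrite (meet_l le_xy); split=> //; rewrite le_xy andbT properEneq eq_sym.
  by rewrite subset_annihilator // andbT orNb.
have /orP[//|/subset_annihilator] := comparable_meet_neq0 xy0.
by rewrite (negPf (proper_subn lt_yx)).
Qed.

Definition twin_seq x := sort <=%O (enum (twins x)).

Lemma mem_twin_seq x y :
  (y \in twin_seq x) = (annihilator y == annihilator x).
Proof. by rewrite mem_sort mem_enum inE. Qed.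

Lemma size_twin_seq x : size (twin_seq x) = #|twins x|.
Proof. by rewrite size_sort -cardE. Qed.

Lemma twin_seq_sorted x : sorted <%O (twin_seq x).
Proof.
rewrite lt_sorted_uniq_le sort_uniq enum_uniq /=.
apply: (sort_sorted_in (P := [in twins x])); last first.
  by apply/allP=> y; rewrite mem_enum.
move=> y z; rewrite !inE => /eqP ey /eqP ez; apply: twins_comparable.
by rewrite ey.
Qed.

Lemma eq_twin_seq x y :
  annihilator x = annihilator y -> twin_seq x = twin_seq y.
Proof. by rewrite /twin_seq /twins => ->. Qed.

(** Write 1 as the join of [y] and [z], which are then incomparable.  A
    nonzero [x] that meets nothing nonzero in 0 is comparable to both.  It
    cannot lie below both, nor between them, because [y] and [z] would be
    comparable; so it lies above both, that is above 1. *)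
Lemma top_reducible_zd_vertex x :
  join_reducible (\top : L) -> zd_vertex x = (x != \bot) && (x != \top).
Proof.
case=> y [z [y1 z1 yz1]]; rewrite /zd_vertex; case: eqVneq => //= x0.
apply/existsP/idP=> [[t /andP[t0]] | x1].
  by apply: contraTneq => ->; rewrite meet1x.
have yz_incomp : ~~ (y >=< z).
  by apply/negP => /orP[le_yz | le_zy]; [move/eqP: z1 | move/eqP: y1];
    rewrite yz1 ?(join_r le_yz) ?(join_l le_zy).
have y0 : y != \bot.
  by apply: contraNneq yz_incomp => ->; rewrite /Order.comparable le0x.
have z0 : z != \bot.
  by apply: contraNneq yz_incomp => ->; rewrite /Order.comparable le0x orbT.
apply/existsP; apply: contraNT yz_incomp; rewrite negb_exists.
move=> /forallP no_ann.
have x_comp t : t != \bot -> x >=< t.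
  by move=> t0; apply: comparable_meet_neq0; have := no_ann t; rewrite t0.
case/orP: (x_comp y y0) (x_comp z z0) => [le_xy | le_yx] /orP[le_xz | le_zx].
- exact: tree le_xz.
- by rewrite /Order.comparable (le_trans le_zx) ?orbT.
- by rewrite /Order.comparable (le_trans le_yx).
by move/negP: x1; rewrite -le1x yz1 leUx le_yx.
Qed.

End Tree.

(** * Order isomorphisms are lattice isomorphisms *)

Section OrderIso.
Variables (d1 d2 : Order.disp_t) (L1 : latticeType d1) (L2 : latticeType d2).
Variable g : L1 -> L2.

Lemma order_isomorphism_lattice : {mono g : x y / x <= y} -> bijective g ->
  lattice_isomorphic L1 L2.
Proof.
move=> g_mono [h gK hK].
have g_homo : {homo g : x y / x <= y} by move=> x y; rewrite g_mono.
have le_gh x y : (g x <= y) = (x <= h y) by rewrite -{1}(hK y) g_mono.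
have le_hg x y : (y <= g x) = (h y <= x) by rewrite -{1}(hK y) g_mono.
have gI : {morph g : x y / x `&` y}.
  by move=> x y; apply: le_anti; rewrite lexI !g_mono leIl leIr le_hg lexI
    -!le_hg leIl leIr.
have gU : {morph g : x y / x `|` y}.
  by move=> x y; apply: le_anti; rewrite leUx !g_mono leUl leUr le_gh leUx
    -!le_gh leUl leUr.
pose g_mor := HB.pack_for {lmorphism L1 -> L2} g
  (Order.isOrderMorphism.Build _ _ _ _ g g_homo)
  (Order.isMeetLatticeMorphism.Build _ _ _ _ g gI)
  (Order.isJoinLatticeMorphism.Build _ _ _ _ g gU).
by exists g_mor; exists h.
Qed.

End OrderIso.

(** * From the zero-divisor relation to the lattice *)

Section TwinMatching.
Variables (d1 d2 : Order.disp_t).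
Variables (L1 : finTBLatticeType d1) (L2 : finTBLatticeType d2).
Hypotheses (tree1 : upsets_chain L1) (tree2 : upsets_chain L2).
Variable F : L1 -> L2.
Hypotheses (F_bij : bijective F)
  (F_meet0 : forall x y, (F x `&` F y == \bot) = (x `&` y == \bot)).

Lemma annihilator_image x : annihilator (F x) = F @: annihilator x.
Proof.
case: F_bij => G FK GK; apply/setP=> y; rewrite inE -(GK y) F_meet0.
by rewrite mem_imset ?inE //; exact: can_inj FK.
Qed.

Lemma annihilator_image_eq x y :
  (annihilator (F x) == annihilator (F y)) = (annihilator x == annihilator y).
Proof.
by rewrite !annihilator_image (inj_eq (imset_inj _)) //; exact: bij_inj.
Qed.

Lemma annihilator_image_proper x y :
  (annihilator (F x) \proper annihilator (F y)) =
    (annihilator x \proper annihilator y).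
Proof.
rewrite !properEneq annihilator_image_eq; congr (_ && _).
rewrite !annihilator_image; apply/idP/idP=> [sub|]; last exact: imsetS.
apply/subsetP=> z xz; rewrite -(mem_imset _ _ (bij_inj F_bij)).
by rewrite (subsetP sub) ?imset_f.
Qed.

Lemma card_twins_image x : #|twins (F x)| = #|twins x|.
Proof.
rewrite -(card_imset _ (bij_inj F_bij)); apply: eq_card => y.
case: F_bij => G FK GK; rewrite inE -(GK y) annihilator_image_eq.
by rewrite mem_imset ?inE //; exact: can_inj FK.
Qed.

(** The image [F x] is replaced by the twin of [F x] that has, among the twins
    of [F x], the rank of [x] among the twins of [x]. *)
Definition twin_match x :=
  nth \bot (twin_seq (F x)) (index x (twin_seq x)).

Lemma index_twin_seq x y : annihilator x = annihilator y ->
  (index x (twin_seq x) < size (twin_seq (F y)))%N.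
Proof.
move=> eq_xy; rewrite size_twin_seq card_twins_image -size_twin_seq.
by rewrite -(eq_twin_seq eq_xy) index_mem mem_twin_seq.
Qed.

Lemma annihilator_twin_match x : annihilator (twin_match x) = annihilator (F x).
Proof. by apply/eqP; rewrite -mem_twin_seq mem_nth // index_twin_seq. Qed.

Lemma twin_match_mono : {mono twin_match : x y / x <= y}.
Proof.
have meet0 x y : (twin_match x `&` twin_match y == \bot) = (x `&` y == \bot).
  have annE (u v : L2) : (u `&` v == \bot) = (v \in annihilator u).
    by rewrite inE.
  rewrite annE annihilator_twin_match -annE [F x `&` _]meetC.
  by rewrite annE annihilator_twin_match -annE meetC F_meet0.
move=> x y; rewrite (le_annihilatorE tree1) (le_annihilatorE tree2).
(* Being 0 is also a matter of meeting in 0: take the meet with itself. *)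
rewrite -[twin_match x == _](congr1 (eq_op^~ _) (meetxx _)) !meet0 meetxx.
rewrite !annihilator_twin_match annihilator_image_eq annihilator_image_proper.
case: (annihilator x =P annihilator y) => //= eq_xy; congr (_ || _ && (_ || _)).
have ix := index_twin_seq eq_xy.
have iy := index_twin_seq (erefl (annihilator y)).
have eq_F : annihilator (F x) = annihilator (F y).
  by apply/eqP; rewrite annihilator_image_eq eq_xy.
rewrite /twin_match (eq_twin_seq eq_F).
rewrite (lt_sorted_leq_nth _ (twin_seq_sorted tree2 _)) //.
rewrite -(lt_sorted_leq_nth \bot (twin_seq_sorted tree1 y)) ?inE;
by rewrite -?(eq_twin_seq eq_xy) ?nth_index ?index_mem ?mem_twin_seq ?eq_xy.
Qed.

Lemma meet0_bijection_isomorphic : lattice_isomorphic L1 L2.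
Proof.
apply: (@order_isomorphism_lattice _ _ _ _ twin_match twin_match_mono).
apply: inj_card_bij; last by rewrite (bij_eq_card F_bij).
by move=> x y eq_xy; apply: le_anti; rewrite -!twin_match_mono eq_xy lexx.
Qed.

End TwinMatching.

(** * Zero-divisor graphs *)

Section ZeroDivisorGraph.
Variables (d : Order.disp_t) (L : finTBLatticeType d).

Lemma zd_vertex_neq0 (u : {x : L | zd_vertex x}) : val u != \bot.
Proof. by case/andP: (valP u). Qed.

Lemma zd_adjE (u v : {x : L | zd_vertex x}) :
  zd_adj u v = (val u `&` val v == \bot).
Proof.
rewrite /zd_adj; case: eqVneq => //= <-.
by rewrite meetxx (negPf (zd_vertex_neq0 u)).
Qed.

Lemma zd_vertex_top : zd_vertex (\top : L) = false.
Proof.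
by apply/negP=> /andP[_ /existsP[y /andP[/negPf y0]]]; rewrite meet1x y0.
Qed.

Lemma join_reducible_top_neq0 : join_reducible (\top : L) -> (\top : L) != \bot.
Proof.
case=> y [z [y1 _ _]]; apply: contraNneq y1 => t0.
by rewrite -le1x t0 le0x.
Qed.

(** The case analysis provided by [top_reducible_zd_vertex]. *)
Variant bot_top_vertex_spec : L -> Prop :=
  | BotSpec : bot_top_vertex_spec \bot
  | TopSpec : bot_top_vertex_spec \top
  | VertexSpec (u : {x : L | zd_vertex x}) : bot_top_vertex_spec (val u).

Lemma bot_top_vertexP x :
  upsets_chain L -> join_reducible (\top : L) -> bot_top_vertex_spec x.
Proof.
move=> tree red; have := top_reducible_zd_vertex tree x red.
case: (eqVneq x \bot) => [-> _ | _]; first exact: BotSpec.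
case: (eqVneq x \top) => [-> _ | _]; first exact: TopSpec.
by move=> vx; have := VertexSpec (exist _ x vx).
Qed.

End ZeroDivisorGraph.

Section Extension.
Variables (d1 d2 : Order.disp_t).
Variables (L1 : finTBLatticeType d1) (L2 : finTBLatticeType d2).
Implicit Type f : {x : L1 | zd_vertex x} -> {x : L2 | zd_vertex x}.

(** The value at elements that are neither 0 nor a vertex is 1, the only such
    element being 1 itself in the lattices considered. *)
Definition extend_vertex_map f (x : L1) : L2 :=
  if x == \bot then \bot
  else if insub x is Some u then val (f u) else \top.

Lemma extend_vertex_map_val f u : extend_vertex_map f (val u) = val (f u).
Proof. by rewrite /extend_vertex_map (negPf (zd_vertex_neq0 u)) valK. Qed.

Lemma extend_vertex_map_bot f : extend_vertex_map f \bot = \bot.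
Proof. by rewrite /extend_vertex_map eqxx. Qed.

Lemma extend_vertex_map_top f : (\top : L1) != \bot ->
  extend_vertex_map f \top = \top.
Proof.
by move=> t0; rewrite /extend_vertex_map (negPf t0) insubF ?zd_vertex_top.
Qed.

End Extension.

Section GraphToLattice.
Variables (d1 d2 : Order.disp_t).
Variables (L1 : finTBLatticeType d1) (L2 : finTBLatticeType d2).
Hypotheses (tree1 : upsets_chain L1) (red1 : join_reducible (\top : L1)).
Hypothesis (red2 : join_reducible (\top : L2)).
Variable f : {x : L1 | zd_vertex x} -> {x : L2 | zd_vertex x}.

Lemma extend_vertex_mapK g : cancel f g ->
  cancel (extend_vertex_map f) (extend_vertex_map g).
Proof.
move=> fK x; have t1 := join_reducible_top_neq0 red1.
have t2 := join_reducible_top_neq0 red2.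
case: (bot_top_vertexP x tree1 red1) => [||u].
- by rewrite !extend_vertex_map_bot.
- by rewrite !extend_vertex_map_top.
by rewrite !extend_vertex_map_val fK.
Qed.

Lemma extend_vertex_map_meet0 : (forall u v, zd_adj (f u) (f v) = zd_adj u v) ->
  forall x y, (extend_vertex_map f x `&` extend_vertex_map f y == \bot) =
    (x `&` y == \bot).
Proof.
move=> f_adj x y; have t1 := join_reducible_top_neq0 red1.
have t2 := join_reducible_top_neq0 red2.
have neq0 u : (val (f u) == \bot) = (val u == \bot).
  by rewrite !(negPf (zd_vertex_neq0 _)).
case: (bot_top_vertexP x tree1 red1) => [||u];
  case: (bot_top_vertexP y tree1 red1) => [||v];
  rewrite ?extend_vertex_map_bot ?extend_vertex_map_top ?extend_vertex_map_val //;
  rewrite ?(meet0x, meetx0, meet1x, meetx1) ?eqxx ?(negPf t1) ?(negPf t2) //.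
by rewrite -!zd_adjE.
Qed.

End GraphToLattice.

Lemma lattice_isomorphic_graph d1 d2 (L1 : finTBLatticeType d1)
    (L2 : finTBLatticeType d2) : lattice_isomorphic L1 L2 ->
  graph_isomorphic (zero_divisor_graph L1) (zero_divisor_graph L2).
Proof.
case=> g [h gK hK].
have g_bot : g \bot = \bot.
  by apply/eqP; rewrite -lex0 -(hK \bot) omorph_le ?le0x.
have g_eq0 x : (g x == \bot) = (x == \bot).
  by rewrite -g_bot (inj_eq (can_inj gK)).
have g_meet0 x y : (g x `&` g y == \bot) = (x `&` y == \bot).
  by rewrite -omorphI g_eq0.
have g_vertex x : zd_vertex (g x) = zd_vertex x.
  rewrite /zd_vertex g_eq0; congr (_ && _); apply/existsP/existsP=> -[y].
    by rewrite -{1 2}(hK y) g_eq0 g_meet0; exists (h y).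
  by exists (g y); rewrite g_eq0 g_meet0.
have g_val (u : {x : L1 | zd_vertex x}) : zd_vertex (g (val u)).
  by rewrite g_vertex (valP u).
have h_val (v : {x : L2 | zd_vertex x}) : zd_vertex (h (val v)).
  by rewrite -g_vertex hK (valP v).
exists (fun u => exist _ (g (val u)) (g_val u)); last first.
  by move=> u v; rewrite /= !zd_adjE /= g_meet0.
exists (fun v => exist _ (h (val v)) (h_val v)) => u; apply: val_inj => /=.
  exact: gK.
exact: hK.
Qed.

Theorem theorem1p1 (d1 d2 : Order.disp_t)
  (L1 : finTBLatticeType d1) (L2 : finTBLatticeType d2)
  (hL1 : lower_dismantlable_top_reducible L1)
  (hL2 : lower_dismantlable_top_reducible L2) :
  graph_isomorphic (zero_divisor_graph L1) (zero_divisor_graph L2) <->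
  lattice_isomorphic L1 L2.
Proof.
split; last exact: lattice_isomorphic_graph.
case: hL1 hL2 => /lower_dismantlable_upsets_chain tree1 red1.
case=> /lower_dismantlable_upsets_chain tree2 red2 [f [g fK gK] f_adj].
apply: (meet0_bijection_isomorphic tree1 tree2 (F := extend_vertex_map f)).
  by exists (extend_vertex_map g); exact: extend_vertex_mapK.
exact: extend_vertex_map_meet0.
Qed.
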